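(* Let $p$ be a prime number and $r$ be a rational number such that $\nu_p(r)\geq 1$. Then for every integer $n\geq 0$, $$ \nu_p(P_n(r)) = \begin{cases} \nu_p\big(\binom{n}{n/2}\big), & \text{if $n$ is even and $p\geq 3$}; \\ \nu_p\big(\binom{n-1}{(n-1)/2}\big) + \nu_p(r) + \nu_p(n), & \text{if $n$ is odd and $p\geq 3$}; \\ \nu_2\big(\binom{n}{n/2}\big)-n, & \text{if $n$ is even and $p=2$}; \\ \nu_2\big(\binom{n-1}{(n-1)/2}\big) + \nu_2(r) + 1 - n, & \text{if $n$ is odd and $p=2$}. \end{cases} $$ Equivalently, $$\nu_p(P_n(r)) = \nu_p\Big(\frac1{2^n}\binom{n}{\lfloor n/2\rfloor}\Big) + (n\bmod 2)\, \nu_p\big(r(n+1)\big).$$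
   Context: $P_n(x)$ denotes the $n$-th Legendre polynomial, which can be written as $P_n(x) = \sum_{k=0}^{n} \binom{n}{k}\binom{n+k}{k}\left(\frac{x-1}{2}\right)^k$. For a prime $p$ and a nonzero rational $r=\pm a/b$ with positive integers $a,b$, $\nu_p(r)=\nu_p(a)-\nu_p(b)$, where $\nu_p(a)=\max\{i: p^i\mid a\}$; also $\nu_p(0)=+\infty$. *)

(* Defs.v *)
From HB Require Import structures.
From mathcomp Require Import all_boot all_order all_algebra.
From mathcomp Require Import constructive_ereal.
Set Implicit Arguments.
Unset Strict Implicit.
Unset Printing Implicit Defensive.
Import Order.TTheory GRing.Theory Num.Theory.
Local Open Scope ring_scope.

Definition legendre (n : nat) : {poly rat} :=
  \sum_(k < n.+1) ('C(n, k) * 'C(n + k, k))%:R *: (2^-1 *: ('X - 1)) ^+ k.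

(* The value is computed on the reduced fraction of r; nu_frac shows that any
   other fraction gives the same value. *)
Definition nu (p : nat) (r : rat) : \bar int :=
  if r == 0 then +oo%E
  else ((logn p `|numq r|)%:Z - (logn p `|denq r|)%:Z)%:E.

Lemma nu0 (p : nat) : nu p 0 = +oo%E.
Proof. by rewrite /nu eqxx. Qed.

Lemma nu_frac (p : nat) (r : rat) (a b : nat) :
  (0 < a)%N -> (0 < b)%N -> `|r| = a%:R / b%:R ->
  nu p r = ((logn p a)%:Z - (logn p b)%:Z)%:E.
Proof.
move=> a0 b0 er.
have bR0 : b%:R != 0 :> rat by rewrite pnatr_eq0 -lt0n.
have r0 : r != 0.
  by rewrite -normr_eq0 er mulf_neq0 ?invr_eq0 // pnatr_eq0 -lt0n.
rewrite /nu (negPf r0); congr (_%:E).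
have n0 : (0 < `|numq r|)%N by rewrite absz_gt0 numq_eq0.
have d0 : (0 < `|denq r|)%N by rewrite absz_gt0 denq_neq0.
have e : (`|numq r| * b = a * `|denq r|)%N.
  apply/eqP; rewrite -(eqr_nat rat) !natrM !natr_absz.
  rewrite [`|denq r|]ger0_norm ?denq_ge0 // intr_norm.
  have -> : (numq r)%:~R = r * (denq r)%:~R :> rat by rewrite numqE.
  rewrite normrM er [`|(denq r)%:~R|]ger0_norm ?ler0z ?denq_ge0 //.
  by rewrite mulrAC mulfVK.
have := congr1 (logn p) e.
rewrite !lognM // => {}e.
by apply/eqP; rewrite subr_eq addrAC eq_sym subr_eq -!PoszD e.
Qed.

(* Main.v *)
Require Import Defs.
From HB Require Import structures.
From mathcomp Require Import all_boot all_order all_algebra.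
From mathcomp Require Import constructive_ereal.
From mathcomp Require Import ring zify.
Import Order.TTheory GRing.Theory Num.Theory.
Local Open Scope ring_scope.

(** Rodrigues' formula gives
    P_n = 2^-n sum_i (-1)^i C(n,i) C(2(n-i),n) X^(n-2i).
    Put m = n./2 and s = odd n, and read this from the bottom (i = m - j). The
    lowest term is, up to sign, C(n,m) ((n+1) r)^s, and the j-th term is the
    lowest one times an integer multiple of 2^j r^(2j) / (2j+s)!. As
    (p-1) v_p(N!) < N, each such quotient with j > 0 is divisible by p, so
    P_n(r) = +- 2^-n C(n,m) ((n+1) r)^s (1 + p x) with x p-integral. *)

(** * Divided derivatives of powers, and the valuation of a factorial *)

Lemma derivn_XsubC_exp (R : comNzRingType) (a : R) (m k : nat) :
  (('X - a%:P) ^+ m)^`(k) = ('X - a%:P) ^+ (m - k) *+ m ^_ k.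
Proof.
elim: k => [|k IH]; first by rewrite derivn0 subn0.
rewrite derivnS IH derivMn deriv_exp derivXsubC mul1r -mulrnA.
by rewrite subnS ffactnSr mulnC.
Qed.

Lemma nderivn_XsubC_exp (R : numDomainType) (a : R) (m k : nat) :
  (('X - a%:P) ^+ m)^`N(k) = ('X - a%:P) ^+ (m - k) *+ 'C(m, k).
Proof.
have := derivn_XsubC_exp _ a m k.
rewrite nderivn_def -bin_ffact mulrnA => /polyP e.
(* The factor [k!] is cancelled coefficientwise: the order needed for this is on [R], not on
   polynomials. *)
apply/polyP => i; apply: (pmulrnI (fact_gt0 k)) => /=.
by have := e i; rewrite !coefMn.
Qed.

(** In Legendre's formula each term satisfies [(p-1) * (N %/ p^k) <= N %/ p^(k-1) - N %/ p^k], so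
    the sum telescopes. *)
Lemma logn_fact_lt (p N : nat) :
  prime p -> (0 < N)%N -> (p.-1 * logn p N`! < N)%N.
Proof.
move=> hp N0; have p1 := prime_gt1 hp; rewrite logn_fact //.
have tel K : (p.-1 * (\sum_(1 <= k < K.+1) N %/ p ^ k) + N %/ p ^ K <= N)%N.
  elim: K => [|K IH]; first by rewrite big_geq // muln0 expn0 divn1.
  apply: leq_trans IH.
  rewrite big_nat_recr //= mulnDr -addnA leq_add2l expnSr divnMA.
  have := leq_trunc_div (N %/ p ^ K) p; nia.
(* [p^K] is the largest power of [p] up to [N]: the terms beyond [K] vanish, and the leftover
   [N %/ p^K >= 1] makes the bound strict. *)
have /andP[] := trunc_log_bounds p1 N0; set K := trunc_log p N => lK uK.
have KN : (K <= N)%N by apply: leq_trans lK; apply/ltnW/ltn_expl.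
have tail0 : (\sum_(K.+1 <= k < N.+1) N %/ p ^ k = 0)%N.
  rewrite big_nat_cond big1 // => k /andP[/andP[Kk _] _].
  by apply: divn_small; apply: leq_trans uK _; rewrite leq_exp2l.
apply: leq_trans (tel K); rewrite (@big_cat_nat _ _ _ K.+1) //= tail0.
by rewrite addn0 -addn1 leq_add2l divn_gt0 // expn_gt0 ltnW.
Qed.

(** * Expansions of the Legendre polynomial and their coefficients *)

Lemma fact_double (a : nat) :
  ((2 * a)`! = 2 ^ a * a`! * \prod_(0 <= i < a) (2 * i).+1)%N.
Proof.
elim: a => [|a IH]; first by rewrite big_geq.
have -> : (2 * a.+1 = (2 * a).+2)%N by lia.
rewrite big_nat_recr //= 2!factS IH expnS factS.
have -> : (2 * a).+2 = (2 * a.+1)%N by lia.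
ring.
Qed.

(** Expanding the second factor of [(X - 1) * (2 + (X - 1))] turns the [n]-th power into a
    combination of the [(X - 1)^(n + k)], whose divided derivatives are the terms of [legendre]. *)
Lemma legendre_rodrigues (n : nat) :
  legendre n = 2 ^- n *: (('X ^+ 2 - 1) ^+ n)^`N(n).
Proof.
have -> : 'X ^+ 2 - 1 = ('X - 1%:P) * (2%:P + ('X - 1%:P)) :> {poly rat}.
  by rewrite polyCMn; ring.
rewrite exprMn [(2%:P + _) ^+ n]exprDn mulr_sumr linear_sum /= scaler_sumr.
apply: eq_bigr => k _.
have kn : (k <= n)%N by rewrite -ltnS.
rewrite mulrnAr mulrCA -exprD linearMn /= -polyC_exp mul_polyC linearZ /=.
rewrite nderivn_XsubC_exp addKn -['C(n + k, n)]bin_sub ?leq_addr // addKn.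
rewrite exprZn.
rewrite -!scaler_nat !scalerA; congr (_ *: _).
rewrite natrM -[in X in _ ^- X](subnK kn) exprD invfM exprVn.
have : 2 ^+ (n - k) != 0 :> rat by rewrite expf_neq0.
by move: (2 ^+ (n - k)) (2 ^- k) => y z y0; field.
Qed.

Lemma legendre_expand (n : nat) :
  legendre n = 2 ^- n *:
    \sum_(i < n./2.+1)
      (-1) ^+ i *: 'X^(n - 2 * i) *+ ('C(n, i) * 'C(2 * (n - i), n)).
Proof.
rewrite legendre_rodrigues; congr (_ *: _).
pose F i : {poly rat} :=
  (-1) ^+ i *: 'X^(n - 2 * i) *+ ('C(n, i) * 'C(2 * (n - i), n)).
have le_half : (n./2.+1 <= n.+1)%N by lia.
rewrite exprBn linear_sum /= (big_ord_widen n.+1 F le_half) /F.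
rewrite [RHS]big_mkcond /=; apply: eq_bigr => i _.
rewrite expr1n mulr1 linearMn /= -exprM.
have -> : (-1) ^+ i = ((-1) ^+ i)%:P :> {poly rat} by rewrite rmorphXn rmorphN1.
rewrite mul_polyC linearZ /= nderivnXn.
(* For [i > n./2] the power [X^(2(n-i))] has degree below [n], so its [n]-th derivative vanishes. *)
case: ltnP => hi.
  rewrite -scalerMnr -mulrnA mulnC.
  by congr (_ *: 'X^_ *+ _); lia.
by rewrite bin_small ?mulr0n ?scaler0 ?mul0rn //; have := ltn_ord i; lia.
Qed.

(* The [j]-th coefficient from the bottom, relative to the bottom one: the
   factor [(m + j + s)!] cancels against the odd part of [(2 (m + j + s))!]. *)
Lemma legendre_coef_ratio (m s j : nat) : (j <= m)%N ->
  ('C(2 * m + s, m - j) * 'C(2 * (m + s + j), 2 * m + s) * (2 * j + s)`! =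
   2 ^ j * (m ^_ j * \prod_(m + s <= i < m + s + j) (2 * i).+1) *
   ('C(2 * m + s, m) * 'C(2 * (m + s), 2 * m + s) * s`!))%N.
Proof.
move=> jm.
(* The right-hand side depends on [k] only through [m + s + k], so the ratio comes from comparing
   [k = j] with [k = 0]. *)
have e k : (k <= m)%N ->
    ('C(2 * m + s, m - k) * 'C(2 * (m + s + k), 2 * m + s) * (2 * k + s)`! *
       (m - k)`! =
     2 ^ (m + s + k) * \prod_(0 <= i < m + s + k) (2 * i).+1)%N.
  move=> km; apply/eqP; rewrite -(eqn_pmul2r (fact_gt0 (m + s + k))); apply/eqP.
  have := fact_double (m + s + k).
  have h1 : (2 * m + s <= 2 * (m + s + k))%N by lia.
  have h2 : (m - k <= 2 * m + s)%N by lia.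
  rewrite -(bin_fact h1) -(bin_fact h2).
  have -> : (2 * m + s - (m - k) = m + s + k)%N by lia.
  have -> : (2 * (m + s + k) - (2 * m + s) = 2 * k + s)%N by lia.
  nia.
apply/eqP; rewrite -(eqn_pmul2r (fact_gt0 (m - j))); apply/eqP.
have h := e 0%N isT.
rewrite addn0 subn0 muln0 add0n -(ffact_fact jm) in h.
rewrite e // (@big_cat_nat _ _ _ (m + s)) ?leq_addr //= expnD mulnACA -h.
ring.
Qed.

(** * Additivity of the valuation, and p-integral rationals *)

Lemma nu_nat (p a : nat) : (0 < a)%N -> nu p a%:R = (logn p a)%:Z%:E.
Proof.
move=> a0; rewrite (@nu_frac p a%:R a 1) ?divr1 ?normr_nat //.
by rewrite logn1 subr0.
Qed.

Lemma nu_frac_repr (x : rat) : x != 0 ->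
  exists a b : nat, [/\ (0 < a)%N, (0 < b)%N & `|x| = a%:R / b%:R].
Proof.
move=> x0; exists `|numq x|%N, `|denq x|%N.
rewrite !absz_gt0 numq_eq0 x0 denq_neq0; split=> //.
rewrite -[in LHS](divq_num_den x) normrM normfV !natr_absz.
by rewrite !intr_norm.
Qed.

Lemma nuM (p : nat) (x y : rat) : nu p (x * y) = (nu p x + nu p y)%E.
Proof.
(* [nu] never takes the value [-oo], so a zero factor makes the sum [+oo]. *)
have [->|x0] := eqVneq x 0.
  by rewrite mul0r nu0 addye // /nu; case: ifP.
have [->|y0] := eqVneq y 0.
  by rewrite mulr0 nu0 addey // /nu (negPf x0).
have [a [b [a0 b0 ex]]] := nu_frac_repr _ x0.
have [c [d [c0 d0 ey]]] := nu_frac_repr _ y0.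
rewrite (nu_frac p a0 b0 ex) (nu_frac p c0 d0 ey).
have e : `|x * y| = (a * c)%:R / (b * d)%:R.
  by rewrite normrM ex ey !natrM mulf_div.
rewrite (nu_frac p _ _ e) ?muln_gt0 ?a0 ?b0 // -EFinD !lognM //.
by congr (_%:E); lia.
Qed.

Lemma nu_sign (p m : nat) : nu p ((-1) ^+ m) = 0%:E.
Proof.
by rewrite (@nu_frac p _ 1 1) ?normrX ?normrN1 ?expr1n ?divr1 // subrr.
Qed.

(** For prime [p], the localization of the integers at [p]. The fraction may be unreduced, which
    makes closure under sums and products immediate. *)
Definition pintegral (p : nat) (x : rat) : Prop :=
  exists a : int, exists2 b : nat, ~~ (p %| b)%N & x = a%:~R / b%:R.

Section PIntegral.
Context (p : nat) (hp : prime p).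

Lemma ndvdn_neq0 (b : nat) : ~~ (p %| b)%N -> b%:R != 0 :> rat.
Proof. by case: b => [|b]; rewrite ?dvdn0 // pnatr_eq0. Qed.

Lemma pintegral_int (a : int) : pintegral p a%:~R.
Proof. by exists a, 1%N; rewrite ?divr1 // dvdn1 neq_ltn prime_gt1 ?orbT. Qed.

Lemma pintegralD (x y : rat) :
  pintegral p x -> pintegral p y -> pintegral p (x + y).
Proof.
move=> [a [b hb ->]] [c [d hd ->]].
exists (a * d%:Z + c * b%:Z), (b * d)%N.
  by rewrite Euclid_dvdM // negb_or hb.
by rewrite addf_div ?ndvdn_neq0 // natrM rmorphD !rmorphM.
Qed.

Lemma pintegralM (x y : rat) :
  pintegral p x -> pintegral p y -> pintegral p (x * y).
Proof.
move=> [a [b hb ->]] [c [d hd ->]].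
exists (a * c), (b * d)%N; first by rewrite Euclid_dvdM // negb_or hb.
by rewrite mulf_div natrM rmorphM.
Qed.

Lemma pintegralX (x : rat) (k : nat) : pintegral p x -> pintegral p (x ^+ k).
Proof.
move=> hx; elim: k => [|k IH]; first exact: (pintegral_int 1).
by rewrite exprS; apply: pintegralM.
Qed.

Lemma pintegral_sum (I : Type) (r : seq I) (F : I -> rat) :
  (forall i, pintegral p (F i)) -> pintegral p (\sum_(i <- r) F i).
Proof.
move=> hF; apply: big_ind => //; first exact: (pintegral_int 0).
exact: pintegralD.
Qed.

(** In the reduced fraction [p] divides the numerator, hence not the denominator, which also serves
    for [u]. *)
Lemma nu_ge1_factor (r : rat) :
  (1%:E <= nu p r)%E -> exists2 u, pintegral p u & r = p%:R * u.
Proof.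
rewrite /nu; case: eqP => [-> _|/eqP r0].
  by exists 0; rewrite ?mulr0 //; apply: (pintegral_int 0).
rewrite lee_fin => h.
have pn : (p %| `|numq r|)%N.
  by apply: dvdn_trans (pfactor_dvdnn p _); apply: dvdn_exp => //; lia.
have pd : ~~ (p %| `|denq r|)%N.
  apply/negP => pd; have := coprime_num_den r.
  rewrite /coprime => /eqP g; have := prime_gt1 hp.
  by rewrite ltnNge dvdn_leq // -g dvdn_gcd pn pd.
have /dvdzP[a ea] : (p %| numq r)%Z by [].
exists (a%:~R / `|denq r|%:R); first by exists a, `|denq r|%N.
rewrite -[LHS]divq_num_den ea rmorphM /= mulrA natr_absz.
by rewrite [`|denq r|]ger0_norm ?denq_ge0 // -[p%:~R]/(p%:R) [_ * p%:R]mulrC.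
Qed.

(** For [x = a / b] the sum is [(b + p a) / b], whose numerator is congruent to [b] modulo [p]. *)
Lemma nu_1DpM (x : rat) : pintegral p x -> nu p (1 + p%:R * x) = 0%:E.
Proof.
move=> [a [b hb ->]]; have b0 := ndvdn_neq0 _ hb.
pose c : int := b%:Z + p%:Z * a.
have e : 1 + p%:R * (a%:~R / b%:R) = c%:~R / b%:R :> rat.
  by rewrite rmorphD rmorphM /= -!pmulrn; field.
have hc : ~~ (p %| `|c|)%N.
  have -> : (p %| `|c|)%N = (p %| c)%Z by [].
  by rewrite /c rpredDr // dvdz_mulr.
have c0 : (0 < `|c|)%N by case: absz hc; rewrite ?dvdn0.
have b0' : (0 < b)%N by case: (b) hb; rewrite ?dvdn0.
rewrite (@nu_frac p _ `|c|%N b) //.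
  by rewrite lognE (negPf hc) [logn p b]lognE (negPf hb) !andbF.
by rewrite e normrM normfV normr_nat natr_absz intr_norm.
Qed.

Lemma pow_div_fact (j s : nat) : (0 < j)%N -> (s <= 1)%N ->
  exists2 x, pintegral p x &
    2 ^+ j * p%:R ^+ (2 * j) / (2 * j + s)`!%:R = p%:R * x :> rat.
Proof.
move=> j0 s1; set N := (2 * j + s)%N.
have N0 : (0 < N)%N by rewrite /N; lia.
have [q cpq ef] := pfactor_coprime hp (fact_gt0 N).
have lt := logn_fact_lt _ _ hp N0; move: ef lt; set e := logn p N`! => ef lt.
have nq : ~~ (p %| q)%N by rewrite -prime_coprime.
have q0 := ndvdn_neq0 _ nq.
have p0 : p%:R != 0 :> rat by rewrite pnatr_eq0 -lt0n prime_gt0.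
(* With [N! = q p^e] and [q] prime to [p], any [p^t] with [t > e] leaves a spare factor [p]. *)
have key (c t : nat) : (e < t)%N ->
    exists2 x, pintegral p x & c%:R * p%:R ^+ t / N`!%:R = p%:R * x :> rat.
  move=> et; exists ((c * p ^ (t - e.+1))%N%:Z%:~R / q%:R).
    by exists (c * p ^ (t - e.+1))%N%:Z, q.
  rewrite ef -[in LHS](subnK et) -pmulrn !natrM !natrX exprD exprS.
  have : p%:R ^+ e != 0 :> rat by rewrite expf_neq0.
  by move: (p%:R ^+ e) (p%:R ^+ (t - e.+1)) => y z y0; field; rewrite q0 y0.
(* For [p = 2] only [e <= 2j] is known, and [2^j] raises the exponent to [3j > e]. For [p >= 3],
   [2e < 2j + s] gives [e <= j < 2j]. *)
have [p2|p3] := leqP p 2.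
  have {}p2 : p = 2%N by have := prime_gt1 hp; lia.
  have [|x hx ex] := key 1%N (j + 2 * j)%N.
    by move: lt; rewrite p2 /N; lia.
  by exists x; rewrite // -ex mul1r exprD p2.
have [|x hx ex] := key (2 ^ j)%N (2 * j)%N; first by move: lt; rewrite /N; nia.
by exists x; rewrite // -ex natrX.
Qed.

End PIntegral.

(** * Factorization of the value at [r], and the valuation formulas *)

Lemma legendre_factor (p n : nat) (r : rat) : prime p -> (1%:E <= nu p r)%E ->
  exists2 x, pintegral p x & (legendre n).[r] =
    2 ^- n * ((-1) ^+ n./2 * 'C(n, n./2)%:R * (r * (n + 1)%:R) ^+ odd n
              * (1 + p%:R * x)).
Proof.
move=> hp /(nu_ge1_factor _ hp)[u hu er].
set m := n./2; set s : nat := odd n.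
have s1 : (s <= 1)%N by rewrite /s; case: odd.
have en : n = (2 * m + s)%N by rewrite /m /s; lia.
have fs : s`! = 1%N by case: (s) s1 => [|[]].
have f0 k : k`!%:R != 0 :> rat by rewrite pnatr_eq0 -lt0n fact_gt0.
(* The second binomial of the lowest term is [C(n, n)] for even [n] and [C(n + 1, n)] for odd
   [n]. *)
have c0 : 'C(2 * (m + s), 2 * m + s) = ((n + 1) ^ s)%N.
  rewrite [in RHS]en; case: (s) s1 => [|[]] // _; first by rewrite !addn0 binn.
  have -> : (2 * (m + 1) = (2 * m + 1).+1)%N by lia.
  by rewrite binSn expn1 [RHS]addn1.
(* [t j] is the quotient of the [j]-th term by the lowest one, so [t 0 = 1]. *)
pose t j : rat := (-1) ^+ j * (2 ^ j * (m ^_ j *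
  \prod_(m + s <= i < m + s + j) (2 * i).+1))%N%:R * r ^+ (2 * j)
  / (2 * j + s)`!%:R.
have ht (j : 'I_m) : exists2 x, pintegral p x & t j.+1 = p%:R * x.
  have [x hx ex] := pow_div_fact _ hp j.+1 s isT s1.
  pose N := (m ^_ j.+1 * \prod_(m + s <= i < m + s + j.+1) (2 * i).+1)%N.
  (* Since [r = p u], the power of [r] supplies the [p^(2j)] of [pow_div_fact]; the remaining
     factors are p-integral. *)
  exists ((-1) ^+ j.+1 * N%:R * u ^+ (2 * j.+1) * x).
    apply: pintegralM => //; apply: pintegralM => //; last exact: pintegralX.
    apply: pintegralM => //; last exact: (pintegral_int _ hp N%:Z).
    by apply: pintegralX => //; exact: (pintegral_int _ hp (-1)).
  rewrite mulrCA -ex /t -/N er natrM natrX exprMn; ring.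
have [F hF eF] := fin_all_exists2 ht.
exists (\sum_(j < m) F j); first exact: pintegral_sum.
have et j : (j <= m)%N ->
  ((-1) ^+ (m - j) * r ^+ (2 * j + s)) *+
     ('C(n, m - j) * 'C(2 * (m + s + j), n)) =
  (-1) ^+ m * 'C(n, m)%:R * (r * (n + 1)%:R) ^+ s * t j.
  move=> jm; have := legendre_coef_ratio m s j jm; rewrite fs muln1 c0 -en.
  move=> /(congr1 (fun a => a%:R : rat)); rewrite !(natrM, natrX) => e.
  rewrite -mulr_natr natrM.
  have -> : (-1) ^+ (m - j) = (-1) ^+ m * (-1) ^+ j :> rat.
    by rewrite -signr_odd oddB // signr_addb !signr_odd.
  apply: (mulIf (f0 (2 * j + s)%N)); rewrite -[LHS]mulrA e exprD exprMn.
  rewrite /t !(natrM, natrX); field; exact: f0.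
rewrite legendre_expand hornerZ; congr (_ * _).
rewrite horner_sum (reindex_inj rev_ord_inj) /=.
rewrite (eq_bigr (fun j : 'I_m.+1 =>
  (-1) ^+ m * 'C(n, m)%:R * (r * (n + 1)%:R) ^+ s * t j)).
  rewrite -mulr_sumr; congr (_ * _); rewrite big_ord_recl; congr (_ + _).
    by rewrite /t muln0 add0n fs ffactn0 big_geq ?addn0 // !mulr1 divr1.
  by rewrite mulr_sumr; apply: eq_bigr => j _; rewrite -eF.
move=> j _; have jm : (j <= m)%N by rewrite -ltnS.
rewrite -et // subSS hornerMn hornerZ hornerXn.
by rewrite -/m; congr (_ * _ ^+ _ *+ (_ * binomial _ _)); lia.
Qed.

(** Absorption and symmetry of binomials; for [n = 2m + 1] it trades [(n + 1) C(n, m)] for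
    [2 n C(n - 1, m)]. *)
Lemma odd_central_bin (m : nat) :
  ('C(2 * m + 1, m) * (2 * m + 2) = 2 * (2 * m + 1) * 'C(2 * m, m))%N.
Proof.
have e := mul_bin_diag (2 * m).+1 m.
have es : 'C((2 * m).+1, m.+1) = 'C((2 * m).+1, m).
  by rewrite -bin_sub; [congr binomial | ]; lia.
by rewrite !addn1 -mulnA e es; ring.
Qed.

Theorem theorem3 (p : nat) (r : rat) (hp : prime p)
    (hr : (1%:E <= nu p r)%E) (n : nat) :
  [/\ ~~ odd n -> (3 <= p)%N ->
        nu p (legendre n).[r] = nu p 'C(n, n./2)%:R,
      odd n -> (3 <= p)%N ->
        nu p (legendre n).[r]
        = (nu p 'C(n.-1, n.-1./2)%:R + nu p r + nu p n%:R)%E,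
      ~~ odd n -> p = 2%N ->
        nu p (legendre n).[r] = (nu 2 'C(n, n./2)%:R - n%:Z%:E)%E,
      odd n -> p = 2%N ->
        nu p (legendre n).[r]
        = (nu 2 'C(n.-1, n.-1./2)%:R + nu 2 r + 1%:E - n%:Z%:E)%E
    & nu p (legendre n).[r]
      = (nu p (1 / 2 ^+ n * 'C(n, n./2)%:R)%R
         + (n %% 2)%N%:Z%:E * nu p (r * (n + 1)%N%:R)%R)%E].
Proof.
have nu_pow2 : nu p (2 ^- n) = (- (n * logn p 2)%:Z)%:E.
  rewrite (@nu_frac p _ 1 (2 ^ n)) ?expn_gt0 //.
    by rewrite logn1 lognX sub0r.
  by rewrite normfV normrX normr_nat natrX div1r.
(* The sign and the factor [1 + p x] have valuation zero. *)
have main : nu p (legendre n).[r] = (nu p (2 ^- n) + (nu p 'C(n, n./2)%:R +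
    nu p ((r * (n + 1)%:R) ^+ odd n)))%E.
  have [x hx ->] := legendre_factor p n r hp hr.
  by rewrite !nuM nu_sign nu_1DpM // add0e adde0.
have bin_gt0n : (0 < 'C(n, n./2))%N by rewrite bin_gt0; lia.
have log2 : (3 <= p)%N -> logn p 2 = 0%N.
  by move=> p3; rewrite logn_prime // gtn_eqF.
have even_case : ~~ odd n ->
    nu p (legendre n).[r] = (nu p (2 ^- n) + nu p 'C(n, n./2)%:R)%E.
  by move=> /negPf ev; rewrite main ev expr0 (nu_nat p 1) // logn1 adde0.
have odd_case : odd n -> nu p (legendre n).[r] =
    (nu p (2 ^- n) + (nu p r + (nu p 2%:R +
      (nu p n%:R + nu p 'C(n.-1, n.-1./2)%:R))))%E.
  move=> on; rewrite main on expr1; congr (_ + _)%E.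
  rewrite -!nuM mulrCA -!natrM; congr (nu p (_ * _%:R)).
  pose m := n./2; have en : n = (2 * m + 1)%N by rewrite /m; lia.
  have -> : n./2 = m by [].
  have -> : n.-1./2 = m by rewrite en; lia.
  have -> : n.-1 = (2 * m)%N by lia.
  by rewrite mulnA en -odd_central_bin -addnA.
have bin1_gt0 : (0 < 'C(n.-1, n.-1./2))%N by rewrite bin_gt0; lia.
split.
- by move=> /even_case -> p3; rewrite nu_pow2 log2 // muln0 add0e.
- move=> on p3; have n0 : (0 < n)%N by case: (n) on.
  rewrite odd_case // nu_pow2 log2 // muln0 add0e (nu_nat p 2) // log2 // add0e.
  by rewrite [(nu p n%:R + _)%E]addeC addeA [(nu p r + _)%E]addeC.
- move=> /even_case -> p2; rewrite nu_pow2 p2 logn_prime // eqxx muln1.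
  by rewrite addeC EFinN.
- move=> on p2; have n0 : (0 < n)%N by case: (n) on.
  (* The odd [n] contributes nothing; the [+ 1] is the valuation of the factor 2 in [odd_case]. *)
  have ln : logn 2 n = 0%N by rewrite lognE dvdn2 on andbF.
  rewrite odd_case // nu_pow2 p2 !nu_nat // ln logn_prime // eqxx muln1.
  (* [r = 0] is allowed, so the infinite values are split off before the integer arithmetic. *)
  by case: (nu 2 r) => [x| |] //=; rewrite -!EFinD; congr (_%:E); lia.
- rewrite main div1r (nuM p (2 ^- n)) modn2 -addeA; congr (_ + (_ + _))%E.
  (* For even [n] and [r = 0] this relies on the convention that 0 times [+oo] is 0. *)
  by case: odd; rewrite ?mul1e ?mul0e ?expr1 // expr0 (nu_nat p 1) // logn1.
Qed.
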